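(* The sequence of polynomial differential functions $$\mathfrak p_3^{[n]}=4\,\mathfrak g_{n-2},\qquad n\ge2,$$ defines a hierarchy of local motions of null curves whose curvature evolution equations are the members of the KdV hierarchy. That is, for every $n\ge2$, $E\big(u_{(1)}\mathfrak p_3^{[n]}\big)=0$, so that $\mathfrak p_3^{[n]}$ determines a local vector field on $\mathcal M$, and for every local motion $\Gamma(s,t)$ associated with this local vector field, the curvature $\kappa(s,t)$ of $\Gamma(\cdot,t)$ satisfies the $n$-th equation of the KdV hierarchy, $$\frac{\partial\kappa}{\partial t}=-D\mathfrak g_n[\kappa].$$
   Context: **Null curves.** $\mathbb R^{2,1}$ is affine Minkowski 3-space, i.e. $\mathbb R^3$ with the Lorentzian inner product $\langle \mathbf x,\mathbf y\rangle=-(x^1y^3+x^3y^1)+x^2y^2$; $\|\mathbf x\|^2:=\langle\mathbf x,\mathbf x\rangle$. A nonzero timelike or null vector $\mathbf x$ is future-directed if $\langle \mathbf x,\mathbf e_1+\mathbf e_3\rangle<0$, where $(\mathbf e_1,\mathbf e_2,\mathbf e_3)$ is the standard basis. A null curve is a regular smooth parametrized curve $\gamma$ in $\mathbb R^{2,1}$ whose velocity is everywhere a future-directed null vector. A flex point is a point where $\gamma'\wedge\gamma''=0$. A null curve without flex points is parametrized by the natural parameter $s$ if $\|\gamma''(s)\|=1$ for all $s$. For such a curve the Frenet frame consists of $\mathbf t_\gamma=\gamma'$, $\mathbf n_\gamma=\gamma''$, $\mathbf b_\gamma=\gamma'''+\frac12\|\gamma'''\|^2\gamma'$, and the curvature is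 $\kappa_\gamma(s)=\frac14\|\gamma'''(s)\|^2$. $\mathcal M$ denotes the space of null curves $\gamma:\mathbb R\to\mathbb R^{2,1}$ without flex points, parametrized by the natural parameter and defined on all of $\mathbb R$. **Polynomial differential functions.** $J[\mathbf u]$ is the algebra of real polynomials in the variables $u=u_{(0)},u_{(1)},u_{(2)},\dots$ (each element involving finitely many of them). The total derivative is $D\mathfrak w=\sum_{p\ge0}\frac{\partial\mathfrak w}{\partial u_{(p)}}u_{(p+1)}$. For a smooth function $\kappa$ of $s$ (possibly depending also on $t$), $\mathfrak w[\kappa]$ denotes the function obtained by substituting $u_{(p)}=\partial_s^p\kappa$. If $\mathfrak w=D\mathfrak p$ for some $\mathfrak p\in J[\mathbf u]$, $\mathfrak w$ is called a total derivative and $\int\mathfrak w$ denotes the unique primitive $\mathfrak p$ that vanishes at $\mathbf u=\mathbf 0$. The Euler operator is $E(\mathfrak w)=\sum_{\ell\ge0}(-1)^\ell D^\ell\big(\frac{\partial\mathfrak w}{\partial u_{(\ell)}}\big)$; $\mathfrak w$ is a total derivative if and only if $E(\mathfrak w)=0$. Let $\mathcal D=D^3+4u_{(0)}D+2u_{(1)}$. **KdV hierarchy.** It is a known fact (Gardner–Greene–Kruskal–Miura, Lax) that there exist sequences $\{\mathfrak g_n\}_{n\ge0}$, $\{\mathfrak p_n\}_{n\ge0}$ in $J[\mathbf u]$ with $\mathfrak g_0=\frac12$, $\mathfrak p_0=\frac12u_{(0)}$ and satisfying the Lenard recursion $D\mathfrak g_n=\mathcal D\mathfrak g_{n-1}$,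 $\mathfrak g_{n-1}=E(\mathfrak p_{n-1})$, $n\ge1$, where $\mathfrak g_n$ ($n\geq 1$) is the primitive vanishing at $\mathbf u=\mathbf 0$; thus $\mathfrak g_1=u$, $\mathfrak g_2=3u^2+u_{ss}$, $\mathfrak g_3=10u^3+10u\,u_{ss}+5u_s^2+u_{ssss}$, etc. The $n$-th member ($n\ge1$) of the KdV hierarchy is $u_t=-D\mathfrak g_n[u]=-\mathcal D\mathfrak g_{n-1}[u]$; for $n=2$ this is the KdV equation $u_t=-6uu_s-u_{sss}$. **Local vector fields and local motions.** Let $\mathfrak q\in J[\mathbf u]$ satisfy $E(u_{(1)}\mathfrak q)=0$. The local vector field on $\mathcal M$ determined by $\mathfrak q$ is $$V_\gamma=\mathfrak q_1[\kappa_\gamma]\mathbf t_\gamma+\mathfrak q_2[\kappa_\gamma]\mathbf n_\gamma+\mathfrak q[\kappa_\gamma]\mathbf b_\gamma,\qquad \mathfrak q_1=\tfrac12D^2\mathfrak q+\int u_{(1)}\mathfrak q,\quad \mathfrak q_2=-D\mathfrak q$$ (integration constant in $\mathfrak q_1$ taken to be zero). A local motion associated with $V$ is a smooth map $\Gamma(s,t)$, $s\in\mathbb R$, $t$ in an open interval, such that $\Gamma(\cdot,t)\in\mathcal M$ for each $t$ and $\frac{\partial\Gamma}{\partial t}=\mathfrak q_1[\kappa_\Gamma]\mathbf t_\Gamma+\mathfrak q_2[\kappa_\Gamma]\mathbf n_\Gamma+\mathfrak q[\kappa_\Gamma]\mathbf b_\Gamma$, where $\kappa_\Gamma(\cdot,t),\mathbf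 t_\Gamma(\cdot,t),\mathbf n_\Gamma(\cdot,t),\mathbf b_\Gamma(\cdot,t)$ are the curvature and Frenet frame of $\Gamma(\cdot,t)$. *)

(* Defs.v *)
From HB Require Import structures.
From mathcomp Require Import all_boot all_order all_algebra.
From mathcomp Require Import finmap.
From mathcomp Require Import all_classical all_reals all_analysis.
From mathcomp Require Import -(notations) monalg.

Set Implicit Arguments.
Unset Strict Implicit.
Unset Printing Implicit Defensive.

Import Order.TTheory GRing.Theory Num.Theory.
Import numFieldNormedType.Exports.

Local Open Scope classical_set_scope.
Local Open Scope ring_scope.

(** * Polynomial differential functions *)

(* Polynomials in the variables [u_(p)], [p : nat].  The notations of monalg
   clash with those of MathComp-Analysis and are not imported. *)
Definition jet (R : realType) : Type := malg (cmonom nat) R.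
HB.instance Definition _ (R : realType) :=
  GRing.ComAlgebra.copy (jet R) (malg (cmonom nat) R).

Definition jvar (R : realType) (p : nat) : jet R :=
  @mkmalgU (cmonom nat) R (ucm p) 1.

(* [divcm] subtracts exponents with truncation; when [u_(p)] does not occur
   in [m], the coefficient [_ *+ m p] is zero. *)
Definition jpart (R : realType) (p : nat) (w : jet R) : jet R :=
  \sum_(m <- msupp w)
    @mkmalgU (cmonom nat) R
      (divcm m (ucm p)) (mcoeff m w *+ m p).

(* Strict upper bound of the indices of the variables occurring in [w]. *)
Definition jord (R : realType) (w : jet R) : nat :=
  (\max_(m <- msupp w) \max_(p <- finsupp (cmonom_val m)) p.+1)%N.

(* Hence the sums over [p < jord w] below are the sums over all [p]. *)
Lemma jpart_ge_jord (R : realType) (p : nat) (w : jet R) :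
  (jord w <= p)%N -> jpart p w = 0.
Proof.
move=> lewp; rewrite /jpart big_seq big1// => m mw.
have mp0 : cmonom_val m p = 0%N.
  apply/eqP; rewrite -[_ == _]negbK -mem_finsupp; apply/negP => pm.
  have : (p < jord w)%N.
    rewrite /jord (big_rem m mw)/= leq_max; apply/orP; left.
    by rewrite (big_rem p pm)/= leq_max leqnn.
  by rewrite ltnNge lewp.
by rewrite mp0 mulr0n raddf0.
Qed.

Definition jD (R : realType) (w : jet R) : jet R :=
  \sum_(p < jord w) jpart p w * jvar R p.+1.

Definition jeuler (R : realType) (w : jet R) : jet R :=
  \sum_(l < jord w) (-1) ^+ l * iter l (@jD R) (jpart l w).

Definition jeval (R : realType) (x : nat -> R) (w : jet R) : R :=
  mmap idfun
    (fun m : cmonom nat =>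
       \prod_(p <- finsupp (cmonom_val m)) x p ^+ m p) w.

Definition jvanish0 (R : realType) (w : jet R) : Prop :=
  jeval (fun=> 0) w = 0.

(* By convention 0 when [w] is not a total derivative. *)
Definition jint (R : realType) (w : jet R) : jet R :=
  xget 0 [set p | jD p = w /\ jvanish0 p].

Definition jsubst (R : realType) (w : jet R) (k : R -> R) (s : R) : R :=
  jeval (fun p => derive1n p k s) w.

Definition lenard_op (R : realType) (w : jet R) : jet R :=
  jD (jD (jD w)) + 4 * jvar R 0 * jD w + 2 * jvar R 1 * w.

Definition lenard_seq (R : realType) (g p : nat -> jet R) : Prop :=
  [/\ g 0%N = (2^-1 : R)%:A,
      p 0%N = (2^-1 : R) *: jvar R 0 &
      forall n : nat, (0 < n)%N ->
        [/\ jD (g n) = lenard_op (g n.-1),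
            g n.-1 = jeuler (p n.-1) &
            jvanish0 (g n)]].

(** * Null curves in Minkowski 3-space *)

(* The coordinates x^1, x^2, x^3 are the entries of index 0, 1, 2. *)
Definition mink (R : realType) (x y : 'rV[R]_3) : R :=
  - (x ord0 (inord 0) * y ord0 (inord 2) + x ord0 (inord 2) * y ord0 (inord 0))
  + x ord0 (inord 1) * y ord0 (inord 1).

(* The squared pseudo-norm; it may be negative. *)
Definition mnorm2 (R : realType) (x : 'rV[R]_3) : R := mink x x.

Definition future_directed (R : realType) (x : 'rV[R]_3) : Prop :=
  [/\ x != 0, mnorm2 x <= 0 &
      mink x (delta_mx ord0 (inord 0) + delta_mx ord0 (inord 2)) < 0].

(* The bivector, as an antisymmetric tensor. *)
Definition wedge (R : realType) (x y : 'rV[R]_3) : 'M[R]_3 :=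
  x^T *m y - y^T *m x.

Definition smooth_curve (R : realType) (c : R -> 'rV[R]_3) : Prop :=
  forall (n : nat) (s : R), derivable (derive1n n c) s 1.

Definition null_curve (R : realType) (c : R -> 'rV[R]_3) : Prop :=
  [/\ smooth_curve c,
      forall s, derive1 c s != 0 &
      forall s, mnorm2 (derive1 c s) = 0 /\ future_directed (derive1 c s)].

Definition flex_point (R : realType) (c : R -> 'rV[R]_3) (s : R) : Prop :=
  wedge (derive1 c s) (derive1n 2 c s) = 0.

(* The condition [||c''|| = 1], stated for the squared pseudo-norm. *)
Definition natural_param (R : realType) (c : R -> 'rV[R]_3) : Prop :=
  forall s, mnorm2 (derive1n 2 c s) = 1.

Definition null_curves (R : realType) : set (R -> 'rV[R]_3) :=
  [set c | [/\ null_curve c, forall s, ~ flex_point c s & natural_param c]].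

Definition frenet_t (R : realType) (c : R -> 'rV[R]_3) (s : R) : 'rV[R]_3 :=
  derive1 c s.

Definition frenet_n (R : realType) (c : R -> 'rV[R]_3) (s : R) : 'rV[R]_3 :=
  derive1n 2 c s.

Definition frenet_b (R : realType) (c : R -> 'rV[R]_3) (s : R) : 'rV[R]_3 :=
  derive1n 3 c s + (2^-1 * mnorm2 (derive1n 3 c s)) *: derive1 c s.

Definition curvature (R : realType) (c : R -> 'rV[R]_3) (s : R) : R :=
  4^-1 * mnorm2 (derive1n 3 c s).

(** * Local vector fields and local motions *)

Definition local_field (R : realType) (q : jet R) (c : R -> 'rV[R]_3) (s : R) :
    'rV[R]_3 :=
  let q1 := (2^-1 : R) *: jD (jD q) + jint (jvar R 1 * q) in
  let q2 := - jD q in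
  jsubst q1 (curvature c) s *: frenet_t c s
  + jsubst q2 (curvature c) s *: frenet_n c s
  + jsubst q (curvature c) s *: frenet_b c s.

Definition dfst (R : realType) (V : normedModType R) (F : R -> R -> V) :
    R -> R -> V :=
  fun s t => derive1 (F ^~ t) s.

Definition dsnd (R : realType) (V : normedModType R) (F : R -> R -> V) :
    R -> R -> V :=
  fun s t => derive1 (F s) t.

(* [C^k] on the open set [A] of the plane: all mixed partial derivatives of
   order at most [k], in any order, exist and are jointly continuous. *)
Fixpoint class_C (R : realType) (V : normedModType R) (k : nat)
    (A : set (R * R)) (F : R -> R -> V) : Prop :=
  (forall z, A z -> {for z, continuous (fun z : R * R => F z.1 z.2)}) /\
  (if k is k'.+1 then
     [/\ forall z, A z -> derivable (F ^~ z.2) z.1 1 /\ derivable (F z.1) z.2 1,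
         class_C k' A (dfst F) &
         class_C k' A (dsnd F)]
   else True).

Definition smooth_on (R : realType) (V : normedModType R) (A : set (R * R))
    (F : R -> R -> V) : Prop :=
  forall k : nat, class_C k A F.

(* [Gam] is total but only its values at [t] in the open interval [I] matter. *)
Definition local_motion (R : realType) (q : jet R) (I : set R)
    (Gam : R -> R -> 'rV[R]_3) : Prop :=
  [/\ open I /\ is_interval I,
      smooth_on [set z : R * R | I z.2] Gam,
      forall t, I t -> null_curves (Gam ^~ t) &
      forall s t, I t -> derive1 (Gam s) t = local_field q (Gam ^~ t) s].

(* Main.v *)
From HB Require Import structures.
Require Import Defs.
From mathcomp Require Import all_boot all_order all_algebra.
From mathcomp Require Import finmap.
From mathcomp Require Import all_classical all_reals all_analysis.
From mathcomp Require Import -(notations) monalg.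
From mathcomp Require Import ring lra.
Import Order.TTheory GRing.Theory Num.Theory.
Import numFieldNormedType.Exports.
Local Open Scope classical_set_scope.
Local Open Scope ring_scope.

(** Let [g] and [h] be the terms of index [n-2] and [n-1] of the Lenard
    sequence, so that [D h = D^3 g + 4 u D g + 2 u_1 g].  Since
    [D^3 g + 4 u D g + 2 u_1 g = D (D^2 g + 4 u g) - 2 u_1 g], the product
    [4 u_1 g] is the total derivative of [2 (D^2 g + 4 u g - h)]
    ([lenard_primitive]).  The Euler operator kills total derivatives
    ([euler_total_der]), which settles the existence of the vector field of
    [4 g].  The primitive just found vanishes at 0 and a total derivative
    determines its primitive up to a constant ([total_der_ker]), so it is the
    integral that enters the first component of the field.

    Along a null curve [c] in natural parameter, of curvature [k], the scalar
    products of [c'], [c''], [c'''] are known, because they result from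
    differentiating [<c', c'> = 0] and [<c'', c''> = 1].  They give
    [c'''' = - 2 k' c' - 4 k c''] ([null_frame_ode]).  With this equation the
    field [V] of [4 g] can be differentiated three times, and the Lenard
    relation simplifies the result so much that only [h] is left:
    [<c''', V'''> = - 2 (h''' + 4 k h' + 2 k' h)], where [h] is evaluated at
    [k] ([mink_derive1n3_lenard]).  By the Lenard relation for [h], this is
    [-2 D g_n] evaluated at [k], where [g_n] is the term after [h].

    In a local motion [c] depends on [t] with velocity [V].  The mixed partial
    derivatives of a smooth map commute ([schwarz], [dsnd_derive1n]), so [c''']
    has velocity [V'''], and [k = <c''', c'''> / 4] has velocity
    [<c''', V'''> / 2 = - D g_n]. *)

Set Implicit Arguments.
Unset Strict Implicit.
Unset Printing Implicit Defensive.

(** * Total derivative and Euler operator *)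

(** The laws of the partial derivatives [d] of an algebra of polynomials in the
    variables [X p], where only the variables of index below [ord w] occur in
    [w].  They are all that the formal calculus of variations below uses, so
    that its proofs never meet the coefficients of a polynomial. *)
Record partial_calculus (K : numFieldType) (A : comAlgType K) (X : nat -> A)
    (d : nat -> A -> A) (ord : A -> nat) : Prop := PartialCalculus {
  partial_lin : forall p a w v, d p (a *: w + v) = a *: d p w + d p v;
  partial1 : forall p, d p 1 = 0;
  partialM : forall p q w,
    d p (X q * w) = X q * d p w + (if p == q then w else 0);
  partialC : forall p q w, d p (d q w) = d q (d p w);
  partial_ord : forall p w, (ord w <= p)%N -> d p w = 0;
  partial_const : forall w, (forall p, d p w = 0) -> exists c : K, w = c%:A;
  partial_ind : forall P : A -> Prop,
    (forall a w v, P w -> P v -> P (a *: w + v)) ->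
    P 1 -> (forall p w, P w -> P (X p * w)) -> forall w, P w
}.

Definition total_der (K : numFieldType) (A : comAlgType K) (X : nat -> A)
    (d : nat -> A -> A) (ord : A -> nat) (w : A) : A :=
  \sum_(p < ord w) d p w * X p.+1.

Definition euler_op (K : numFieldType) (A : comAlgType K) (X : nat -> A)
    (d : nat -> A -> A) (ord : A -> nat) (w : A) : A :=
  \sum_(l < ord w) (-1) ^+ l * iter l (total_der X d ord) (d l w).

Section PartialCalculus.
Context {K : numFieldType} {A : comAlgType K} {X : nat -> A}.
Context {d : nat -> A -> A} {ord : A -> nat}.
Hypothesis calc : partial_calculus X d ord.
Implicit Types (p q l N : nat) (w v : A).

Local Notation D := (total_der X d ord).
Local Notation E := (euler_op X d ord).

Let dD p w v : d p (w + v) = d p w + d p v.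
Proof. by rewrite -[w]scale1r (partial_lin calc) !scale1r. Qed.

Let d0 p : d p 0 = 0.
Proof. by apply: (addrI (d p 0)); rewrite -dD !addr0. Qed.

(** Sums that involve several elements can only be combined over a common
    range of indices; hence the freedom in the upper bound. *)
Lemma total_derE N w : (ord w <= N)%N -> D w = \sum_(p < N) d p w * X p.+1.
Proof.
move=> le_wN; rewrite /total_der.
rewrite (big_ord_widen_cond _ xpredT (fun p => d p w * X p.+1) le_wN).
rewrite big_mkcond; apply: eq_bigr => p _ /=.
by case: ltnP => // /(partial_ord calc) ->; rewrite mul0r.
Qed.

Lemma total_der_lin a w v : D (a *: w + v) = a *: D w + D v.
Proof.
pose N := maxn (ord (a *: w + v)) (maxn (ord w) (ord v)).
rewrite !(@total_derE N) ?leq_max ?leqnn ?orbT //.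
rewrite scaler_sumr -big_split; apply: eq_bigr => p _ /=.
by rewrite (partial_lin calc) mulrDl scalerAl.
Qed.

Let DD w v : D (w + v) = D w + D v.
Proof. by rewrite -[w]scale1r total_der_lin !scale1r. Qed.

Let D0 : D 0 = 0.
Proof. by apply: (addrI (D 0)); rewrite -DD !addr0. Qed.

Let DZ a w : D (a *: w) = a *: D w.
Proof. by rewrite -[a *: w]addr0 total_der_lin D0 addr0. Qed.

Let DN w : D (- w) = - D w.
Proof. by rewrite -scaleN1r DZ scaleN1r. Qed.

Let Dnat n w : D (n%:R * w) = n%:R * D w.
Proof.
have natE v : n%:R * v = (n%:R : K) *: v by rewrite mulr_natl scaler_nat.
by rewrite !natE DZ.
Qed.

Lemma total_der1 : D 1 = 0.
Proof. by rewrite /total_der big1 // => p _; rewrite (partial1 calc) mul0r. Qed.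

Lemma total_der_varM q w : D (X q * w) = X q * D w + X q.+1 * w.
Proof.
pose N := maxn q.+1 (maxn (ord (X q * w)) (ord w)).
rewrite !(@total_derE N) ?leq_max ?leqnn ?orbT //.
have qN : (q < N)%N by rewrite leq_max leqnn.
rewrite mulr_sumr (eq_bigr (fun p : 'I_N => X q * (d p w * X p.+1) +
  (if p == q :> nat then w else 0) * X p.+1)) => [|p _]; last first.
  by rewrite (partialM calc) mulrDl mulrA.
rewrite big_split /=; congr (_ + _).
rewrite (bigD1 (Ordinal qN)) //= eqxx big1 ?addr0 1?mulrC // => p pq.
by rewrite ifF ?mul0r //; apply: contraNF pq => /eqP E1; apply/eqP/val_inj.
Qed.

(** The commutator of [d l] with the total derivative is [d l.-1]: besides
    acting on the coefficients [d p w], [d l] hits the factor [X p.+1] for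
    [p.+1 = l].  The formula is checked by induction on monomials. *)
Lemma partial_total_der l w :
  d l (D w) = D (d l w) + (if l is l'.+1 then d l' w else 0).
Proof.
elim/(partial_ind calc): w l => [a w v IHw IHv|| q w IH] l.
- rewrite total_der_lin !(partial_lin calc) total_der_lin IHw IHv.
  by case: l => [|l]; rewrite ?addr0 // (partial_lin calc) scalerDr addrACA.
- rewrite total_der1 !(partial1 calc) d0 D0.
  by case: l => [|l]; rewrite ?addr0 // (partial1 calc) addr0.
- rewrite total_der_varM dD !(partialM calc) !DD total_der_varM IH.
  case: l => [|l].
    by rewrite /=; case: eqVneq => _; rewrite ?D0; ring.
  rewrite (partialM calc) eqSS; case: (eqVneq l q) => [->|_].
    by case: eqVneq => _; rewrite ?D0; ring.
  by case: eqVneq => _; rewrite ?D0; ring.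
Qed.

Let iD0 l : iter l D 0 = 0.
Proof. by elim: l => //= l ->. Qed.

Lemma euler_opE N w : (ord w <= N)%N ->
  E w = \sum_(l < N) (-1) ^+ l * iter l D (d l w).
Proof.
move=> le_wN; rewrite /euler_op.
pose F l := (-1) ^+ l * iter l D (d l w).
rewrite (big_ord_widen_cond _ xpredT F le_wN) big_mkcond.
apply: eq_bigr => p _ /=; rewrite /F.
by case: ltnP => // /(partial_ord calc) ->; rewrite iD0 mulr0.
Qed.

(** By the commutation rule, the term of index [l] of [E (D w)] is
    [(-1)^l D^(l+1) (d l w) + (-1)^l D^l (d l.-1 w)], and the second summand
    cancels the first one of the term before.  What is left at the end is a
    derivative with respect to a variable that does not occur in [w]. *)
Lemma euler_total_der w : E (D w) = 0.
Proof.
have iDD l w1 v1 : iter l D (w1 + v1) = iter l D w1 + iter l D v1.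
  by elim: l => //= l ->.
pose N := maxn (ord (D w)) (ord w).
have tele n : \sum_(l < n.+1) (-1) ^+ l * iter l D (d l (D w)) =
    (-1) ^+ n * iter n.+1 D (d n w).
  elim: n => [|n IH].
    by rewrite big_ord1 partial_total_der addr0 !expr0 !mul1r.
  rewrite big_ord_recr IH partial_total_der iDD -iterSr exprS /=; ring.
rewrite (@euler_opE N.+1) ?tele; last by rewrite leqW // leq_maxl.
by rewrite (partial_ord calc) ?leq_maxr // iD0 mulr0.
Qed.

(** If [D w = 0], the commutation rule reads [d l w = - D (d l.+1 w)], so that
    the vanishing of the partial derivatives of [w] propagates downwards from
    the indices of the variables that do not occur in [w]. *)
Lemma total_der_ker w : D w = 0 -> exists c : K, w = c%:A.
Proof.
move=> Dw0; apply: (partial_const calc) => p.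
have [k] := ubnP (ord w - p)%N; elim: k p => // k IH p pk.
have [/(partial_ord calc)//|pw] := leqP (ord w) p.
have := partial_total_der p.+1 w; rewrite Dw0 d0 IH ?D0 ?add0r //.
by rewrite -ltnS (leq_trans _ pk) // ltnS ltn_sub2l.
Qed.

(** By the product rule, the right-hand side of the Lenard relation is
    [D (D (D g) + 4 X0 g) - 2 X1 g], so that the relation between [g] and [h]
    yields a primitive of [X1 g] in closed form. *)
Lemma lenard_primitive g h :
    D h = D (D (D g)) + 4 * X 0%N * D g + 2 * X 1%N * g ->
  D (2 * (D (D g) + 4 * (X 0%N * g) - h)) = X 1%N * (4 * g).
Proof. by move=> Dh; rewrite Dnat DD DN DD Dnat total_der_varM Dh; ring. Qed.

Section Evaluation.
Variables (x : nat -> K) (ev : A -> K).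
Hypothesis ev_lin : forall a w v, ev (a *: w + v) = a * ev w + ev v.
Hypothesis ev1 : ev 1 = 1.
Hypothesis ev_varM : forall p w, ev (X p * w) = x p * ev w.

Let evD w v : ev (w + v) = ev w + ev v.
Proof. by rewrite -[w]scale1r ev_lin mul1r scale1r. Qed.

Let ev0 : ev 0 = 0.
Proof. by apply: (addrI (ev 0)); rewrite -evD !addr0. Qed.

Let evZ a w : ev (a *: w) = a * ev w.
Proof. by rewrite -[a *: w]addr0 ev_lin ev0 addr0. Qed.

Let evM w v : ev (w * v) = ev w * ev v.
Proof.
elim/(partial_ind calc): w => [a w u IHw IHu||p w IH].
- by rewrite mulrDl evD -scalerAl evZ IHw IHu ev_lin mulrDl mulrA.
- by rewrite mul1r ev1 mul1r.
- by rewrite -mulrA !ev_varM IH mulrA.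
Qed.

Let evN w : ev (- w) = - ev w.
Proof. by rewrite -scaleN1r evZ mulN1r. Qed.

Let ev_nat n : ev n%:R = n%:R.
Proof. by rewrite -(scaler_nat n (1 : A)) evZ ev1 mulr1. Qed.

Let evX p : ev (X p) = x p.
Proof. by rewrite -[X p]mulr1 ev_varM ev1 mulr1. Qed.

Lemma eval_total_der_at0 : (forall p, x p = 0) -> forall w, ev (D w) = 0.
Proof.
move=> x0 w; rewrite /total_der.
elim/big_rec: _ => [|p v _ IH]; first exact: ev0.
by rewrite evD IH mulrC ev_varM x0 mul0r addr0.
Qed.

Lemma total_der_inj_eval w v : D w = D v -> ev w = ev v -> w = v.
Proof.
move=> Dwv ewv; have [c wvc] : exists c : K, w - v = c%:A.
  by apply: total_der_ker; rewrite DD DN Dwv subrr.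
have := congr1 ev wvc; rewrite evD evN evZ ev1 ewv subrr mulr1 => c0.
by apply/eqP; rewrite -subr_eq0 wvc -c0 scale0r.
Qed.

Lemma eval_lenard_primitive g h :
  ev (2 * (D (D g) + 4 * (X 0%N * g) - h)) =
  2 * (ev (D (D g)) + 4 * (x 0%N * ev g) - ev h).
Proof. by rewrite !(evD, evN, evM, ev_nat, evX). Qed.

Lemma eval_lenard g : ev (D (D (D g)) + 4 * X 0%N * D g + 2 * X 1%N * g) =
  ev (D (D (D g))) + 4 * x 0%N * ev (D g) + 2 * x 1%N * ev g.
Proof. by rewrite !(evD, evM, ev_nat, evX). Qed.

(** The coefficients of the local vector field of [q = 4 g], with the integral
    replaced by the primitive found in [lenard_primitive]. *)
Lemma eval_field_coefs g h (q := 4 * g) :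
  [/\ ev (2^-1 *: D (D q) + 2 * (D (D g) + 4 * (X 0%N * g) - h)) =
        4 * ev (D (D g)) + 8 * x 0%N * ev g - 2 * ev h,
      ev (- D q) = - (4 * ev (D g)) &
      ev q = 4 * ev g].
Proof.
rewrite /q !Dnat !(evD, evN, evZ, evM, ev_nat, evX).
by split=> //; field.
Qed.

End Evaluation.

End PartialCalculus.

(** * Partial derivatives and evaluation of jets *)

Section Jets.
Context {R : realType}.
Implicit Types (m : cmonom nat) (p q : nat) (w v g h : jet R) (x : nat -> R).

Lemma jcoefD m w v : mcoeff m (w + v) = mcoeff m w + mcoeff m v.
Proof. exact: (@mcoeffD (cmonom nat) R). Qed.

Lemma jcoefZ m a w : mcoeff m (a *: w) = a * mcoeff m w.
Proof. exact: (@mcoeffZ (cmonom nat) R). Qed.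

Lemma jcoefL m a w v : mcoeff m (a *: w + v) = a * mcoeff m w + mcoeff m v.
Proof. by rewrite jcoefD; congr (_ + _); exact: jcoefZ. Qed.

Lemma jmonomM m1 m2 :
  @mkmalgU (cmonom nat) R (mmul m1 m2) 1 =
    (@mkmalgU (cmonom nat) R m1 1 : jet R) * @mkmalgU (cmonom nat) R m2 1.
Proof.
rewrite -{1}[1 in LHS]mulr1 -fgmulUU; symmetry.
exact: (@malgM_def (cmonom nat) R).
Qed.

Lemma cmonomP m1 m2 : (forall i, m1 i = m2 i) -> m1 = m2.
Proof. by move=> E; apply/eqP/cmP. Qed.

Lemma cmonom_neq1 m : m != mone -> exists p, (0 < m p)%N.
Proof.
move=> m1; apply: contrapT => /forallNP m0; move/eqP: m1; apply.
apply: cmonomP => i; rewrite cm1.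
by apply/eqP; rewrite -leqn0 leqNgt; exact/negP.
Qed.

Lemma ucm_mulcmK p m : (0 < m p)%N -> mmul (ucm p) (divcm m (ucm p)) = m.
Proof.
move=> mp; apply: cmonomP => i; rewrite cmM divcmE ucmE.
by case: eqVneq => [<-|_] /=; [rewrite subnKC | rewrite subn0].
Qed.

(** In terms of coefficients, no truncated division is left.  Linearity,
    commutation and the product rule are read off from this formula. *)
Lemma mcoeff_jpart m p w :
  mcoeff m (jpart p w) = mcoeff (mmul (ucm p) m) w *+ (m p).+1.
Proof.
have divE m' : (0 < m' p)%N ->
    (divcm m' (ucm p) == m) = (m' == mmul (ucm p) m).
  move=> m'p; apply/eqP/eqP => [<-|->]; first by rewrite ucm_mulcmK.
  by apply: cmonomP => i; rewrite divcmE cmM addKn.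
pose G m' := mcoeff m' w *+ m' p *+ (m' == mmul (ucm p) m).
rewrite /jpart raddf_sum /= (eq_bigr G) => [|m' _]; last first.
  rewrite mcoeffU /G; case: (posnP (m' p)) => [->|/divE->//].
  by rewrite mulr0n !mul0rn.
have up : (mmul (ucm p) m) p = (m p).+1 by rewrite cmM ucmE eqxx.
case: (boolP (mmul (ucm p) m \in msupp w)) => mw.
  rewrite (big_fsetD1 _ mw) /= /G eqxx up big_seq big1 ?addr0 // => m'.
  by rewrite in_fsetD1 => /andP[/negPf->]; rewrite mulr0n.
rewrite (mcoeff_outdom mw) mul0rn big_seq big1 // => m' m'w.
by rewrite /G; case: eqVneq => [E|//]; rewrite -E m'w in mw.
Qed.

Lemma jpart_is_linear p : linear (@jpart R p).
Proof.
move=> a w v; apply/malgP => m.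
etransitivity; first exact: mcoeff_jpart.
etransitivity; last by symmetry; exact: jcoefL.
rewrite jcoefL mulrnDl -mulrnAr.
by congr (a * _ + _); symmetry; exact: mcoeff_jpart.
Qed.

Lemma jpartC p q w : jpart p (jpart q w) = jpart q (jpart p w).
Proof.
apply/malgP => m.
have E p1 q1 : mcoeff m (jpart p1 (jpart q1 w)) =
    mcoeff (mmul (ucm q1) (mmul (ucm p1) m)) w *+
      ((mmul (ucm p1) m q1).+1 * (m p1).+1).
  etransitivity; first exact: mcoeff_jpart.
  by rewrite mulrnA; congr (_ *+ _); exact: mcoeff_jpart.
etransitivity; first exact: E.
etransitivity; last (symmetry; exact: E).
rewrite !cmM !ucmE; congr (mcoeff _ w *+ _).
  by apply: cmonomP => i; rewrite !cmM addnCA.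
case: (eqVneq p q) => [->//|_] /=.
by rewrite !add0n mulnC.
Qed.

Lemma cmonom_ind (Q : cmonom nat -> Prop) :
  Q mone -> (forall p m, Q m -> Q (mmul (ucm p) m)) -> forall m, Q m.
Proof.
move=> Q1 QM m; have [n] := ubnP (mdeg m); elim: n m => // n IH m mn.
have [->//|m1] := eqVneq m mone.
have [p mp] := cmonom_neq1 m1.
rewrite -(ucm_mulcmK mp); apply/QM/IH; move: mn.
by rewrite -[in X in X -> _](ucm_mulcmK mp) mdegM mdegU ltnS.
Qed.

Lemma jmonom_ind (P : jet R -> Prop) :
    (forall a w v, P w -> P v -> P (a *: w + v)) ->
    P 1 -> (forall p w, P w -> P (jvar R p * w)) ->
  forall w, P w.
Proof.
move=> Plin P1 Pvar.
have P0 : P 0 by have := Plin (-1) _ _ P1 P1; rewrite scaleN1r addNr.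
have Pm m : P (@mkmalgU (cmonom nat) R m 1).
  elim/cmonom_ind: m => [|p m Pm]; first exact: P1.
  rewrite jmonomM; exact: Pvar.
move=> w; rewrite [w]monalgE.
apply: (big_ind P P0) => [v1 v2 Pv1 Pv2|m _].
  rewrite -[v1](scale1r v1 : 1 *: v1 = v1); exact: Plin Pv1 Pv2.
have -> : @mkmalgU (cmonom nat) R m (mcoeff m w) =
    mcoeff m w *: (@mkmalgU (cmonom nat) R m 1 : jet R) + 0.
  move: (mcoeff m w) => c; rewrite addr0; apply/malgP => m'.
  etransitivity; last (symmetry; exact: jcoefZ).
  have E c' := mcoeffU m c' m' : mcoeff m' (mkmalgU m c') = c' *+ (m == m').
  etransitivity; first exact: E.
  by rewrite -[in LHS](mulr1 c) -mulrnAr; congr (c * _); symmetry; exact: E.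
exact: Plin (Pm m) P0.
Qed.

Lemma jcoef_jvarM q m w : mcoeff (mmul (ucm q) m) (jvar R q * w) = mcoeff m w.
Proof.
etransitivity; first exact: (@mcoeffMl (cmonom nat) R).
rewrite /jvar msuppU oner_eq0 big_seq_fset1 mcoeffUU.
rewrite (eq_bigr (fun k => mcoeff k w *+ (k == m))) => [|k _]; last first.
  rewrite mul1r; congr (_ *+ _); congr nat_of_bool.
  apply/eqP/eqP => [E|-> //]; apply: cmonomP => i; apply: (@addnI (ucm q i)).
  by rewrite -!cmM E.
case: (boolP (m \in msupp w)) => mw.
  rewrite (big_fsetD1 _ mw) /= eqxx big_seq big1 ?addr0 // => k.
  by rewrite in_fsetD1 => /andP[/negPf->]; rewrite mulr0n.
rewrite (mcoeff_outdom mw) big_seq big1 // => k kw.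
by case: eqVneq => [E|//]; rewrite -E kw in mw.
Qed.

Lemma jcoef_jvarM0 q m w : m q = 0%N -> mcoeff m (jvar R q * w) = 0.
Proof.
move=> mq; etransitivity; first exact: (@mcoeffMl (cmonom nat) R).
rewrite /jvar msuppU oner_eq0 big_seq_fset1 big1 // => k _.
by case: eqVneq => // E; move: mq; rewrite -E cmM ucmE eqxx.
Qed.

(** Multiplication by a variable shifts the coefficients ([jcoef_jvarM]), and
    the factor [(m p).+1] of [mcoeff_jpart] exceeds the one of the shifted
    monomial by one exactly when [p = q]. *)
Lemma jpart_jvarM p q w :
  jpart p (jvar R q * w) = jvar R q * jpart p w + (if p == q then w else 0).
Proof.
apply/malgP => m; etransitivity; first exact: mcoeff_jpart.
etransitivity; last (symmetry; exact: jcoefD).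
case: (eqVneq p q) => [<-|pq].
  rewrite jcoef_jvarM mulrS addrC; congr (_ + _).
  case: (posnP (m p)) => [mp|mp].
    by rewrite mp mulr0n; symmetry; exact: jcoef_jvarM0.
  rewrite -(ucm_mulcmK mp).
  etransitivity; last (symmetry; exact: jcoef_jvarM).
  etransitivity; last (symmetry; exact: mcoeff_jpart).
  by rewrite cmM ucmE eqxx.
have -> : mcoeff m (0 : jet R) = 0 by exact: (@mcoeff0 (cmonom nat) R).
rewrite addr0; case: (posnP (m q)) => [mq|mq].
  rewrite [RHS]jcoef_jvarM0 // [X in X *+ _]jcoef_jvarM0 ?mul0rn //.
  by rewrite cmM ucmE (negPf pq) mq.
rewrite -(ucm_mulcmK mq).
etransitivity; last (symmetry; exact: jcoef_jvarM).
etransitivity; last (symmetry; exact: mcoeff_jpart).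
rewrite cmM ucmE eq_sym (negPf pq) add0n; congr (_ *+ _).
etransitivity; last exact: (jcoef_jvarM q).
by congr (mcoeff _ _); apply: cmonomP => i; rewrite !cmM addnCA.
Qed.

Lemma jpart_eq0_const w : (forall p, jpart p w = 0) -> w = (mcoeff mone w)%:A.
Proof.
move=> w0; apply/malgP => m.
etransitivity; last (symmetry; exact: jcoefZ).
have -> : mcoeff m (1 : jet R) = (m == mone)%:R.
  exact: (@mcoeff1 (cmonom nat) R).
have [->|m1] := eqVneq m mone; first by rewrite mulr1.
have [p mp] := cmonom_neq1 m1.
have := mcoeff_jpart (divcm m (ucm p)) p w.
rewrite w0 mcoeff0 mulr0 ucm_mulcmK // => /esym/eqP.
by rewrite mulrn_eq0 /= => /eqP.
Qed.

Lemma jpart1 p : jpart p (1 : jet R) = 0.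
Proof.
apply/malgP => m; etransitivity; first exact: mcoeff_jpart.
have -> : mcoeff (mmul (ucm p) m) (1 : jet R) = (mmul (ucm p) m == mone)%:R.
  exact: (@mcoeff1 (cmonom nat) R).
have -> : (mmul (ucm p) m == mone) = false.
  apply/negP => /eqP/(congr1 (fun m' => cmonom_val m' p)).
  by rewrite cmM ucmE eqxx cm1.
by rewrite mul0rn; symmetry; exact: (@mcoeff0 (cmonom nat) R).
Qed.

Lemma jet_calculus : partial_calculus (@jvar R) (@jpart R) (@jord R).
Proof.
split.
- by move=> p a w v; exact: jpart_is_linear.
- exact: jpart1.
- exact: jpart_jvarM.
- by move=> p q w; exact: jpartC.
- by move=> p w; exact: jpart_ge_jord.
- by move=> w /jpart_eq0_const ->; eexists.
- exact: jmonom_ind.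
Qed.

Definition cmonom_eval x (m : cmonom nat) : R :=
  \prod_(p <- finsupp (cmonom_val m)) x p ^+ m p.

Lemma cmonom_evalEw x m (S : {fset nat}) :
    (finsupp (cmonom_val m) `<=` S)%fset ->
  cmonom_eval x m = \prod_(p <- S) x p ^+ m p.
Proof.
move=> mS; rewrite /cmonom_eval (big_fset_incl _ mS) // => p _.
by rewrite memNfinsupp => /eqP ->.
Qed.

Lemma cmonom_eval_mmorphism x : mmorphism (cmonom_eval x).
Proof.
split=> [m1 m2|]; last by rewrite /cmonom_eval mdom1 big_seq_fset0.
have S := mdomD m1 m2.
rewrite (@cmonom_evalEw x m1 _ (fsubsetUl _ (finsupp (cmonom_val m2)))).
rewrite (@cmonom_evalEw x m2 _ (fsubsetUr (finsupp (cmonom_val m1)) _)).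
rewrite /cmonom_eval S -big_split /=; apply: eq_bigr => p _.
by rewrite cmM exprD.
Qed.

HB.instance Definition _ x :=
  @isMultiplicative.Build (cmonom nat) R (cmonom_eval x)
    (cmonom_eval_mmorphism x).

Lemma jeval_lin x a w v : jeval x (a *: w + v) = a * jeval x w + jeval x v.
Proof.
etransitivity; first exact: (@mmapD _ _ _ idfun (cmonom_eval x)).
by congr (_ + _); exact: (@mmapZ (cmonom nat) R R idfun (cmonom_eval x)).
Qed.

Lemma jeval1 x : jeval x 1 = 1.
Proof. exact: (@mmap1 (cmonom nat) R R idfun (cmonom_eval x)). Qed.

Lemma jeval_jvarM x p w : jeval x (jvar R p * w) = x p * jeval x w.
Proof.
etransitivity.
  exact: (@mmap_is_multiplicative (cmonom nat) R R idfun (cmonom_eval x)).1.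
congr (_ * _); etransitivity; first exact: (@mmapU _ _ _ idfun (cmonom_eval x)).
rewrite mul1r (@cmonom_evalEw x _ [fset p]%fset); last by rewrite (mdomU p).
by rewrite big_seq_fset1 ucmE eqxx expr1.
Qed.

Lemma jeuler_jD w : jeuler (jD w) = 0.
Proof. exact: (euler_total_der jet_calculus w). Qed.

Lemma jeval0_jD w : jeval (fun=> 0) (jD w) = 0.
Proof.
apply: (eval_total_der_at0 (jeval_lin (fun=> 0))) => //.
by move=> p v; rewrite jeval_jvarM.
Qed.

(** The choice made in [jint] is forced: two primitives differ by a constant,
    and a constant is its value at 0. *)
Lemma jint_jD w : jvanish0 w -> jint (jD w) = w.
Proof.
move=> w0; apply: xget_unique => [|v [Dv v0]]; first by split.
apply: (total_der_inj_eval jet_calculus (jeval_lin (fun=> 0)) (jeval1 _) Dv).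
by rewrite v0.
Qed.

Lemma jD_lenard_primitive g h : jD h = lenard_op g ->
  jD (2 * (jD (jD g) + 4 * (jvar R 0 * g) - h)) = jvar R 1 * (4 * g).
Proof. exact: (lenard_primitive jet_calculus). Qed.

Lemma jint_lenard g h : jD h = lenard_op g -> jvanish0 h ->
  jint (jvar R 1 * (4 * g)) = 2 * (jD (jD g) + 4 * (jvar R 0 * g) - h).
Proof.
move=> Dh h0.
etransitivity.
  apply: (f_equal (@jint R)); symmetry.
  exact: (jD_lenard_primitive Dh).
apply: jint_jD; etransitivity.
  exact: (eval_lenard_primitive jet_calculus (jeval_lin (fun=> 0)) (jeval1 _)
    (jeval_jvarM (fun=> 0))).
have -> : jeval (fun=> 0) (total_der (@jvar R) (@jpart R) (@jord R)
   (total_der (@jvar R) (@jpart R) (@jord R) g)) = 0 by exact: jeval0_jD.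
by rewrite h0 mul0r mulr0 subr0 addr0 mulr0.
Qed.

End Jets.

(** * Derivatives of functions of a real variable *)

Section Derivatives.
Context {R : realType}.

Lemma is_deriveMfun (f g : R -> R) (s df dg : R) :
  is_derive s 1 f df -> is_derive s 1 g dg ->
  is_derive s 1 (fun r => f r * g r) (df * g s + f s * dg).
Proof.
move=> fd gd.
have -> : df * g s + f s * dg = f s *: dg + g s *: df.
  by rewrite addrC [df * _]mulrC.
exact: is_deriveM.
Qed.

(** For curves this is [smooth_curve]; it is also needed for the curvature. *)
Definition smooth (V : normedModType R) (f : R -> V) :=
  forall (n : nat) (s : R), derivable (derive1n n f) s 1.

Lemma is_derive1n (V : normedModType R) (f : R -> V) (n : nat) (s : R) :
  smooth f -> is_derive s 1 (derive1n n f) (derive1n n.+1 f s).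
Proof. by move=> fs; rewrite derive1nS derive1E; exact: derivableP. Qed.

Lemma is_derive_derive1 (V : normedModType R) (f : R -> V) (s : R) :
  derivable f s 1 -> is_derive s 1 f (derive1 f s).
Proof. by rewrite derive1E => /derivableP. Qed.

Lemma is_derive_unique (f : R -> R) (s d1 d2 : R) :
  is_derive s 1 f d1 -> is_derive s 1 f d2 -> d1 = d2.
Proof. by move=> [_ <-] [_ <-]. Qed.

Lemma is_derive_const (f : R -> R) (a df s : R) :
  is_derive s 1 f df -> (forall r, f r = a) -> df = 0.
Proof.
move=> fs /funext fE; apply: (is_derive_unique fs).
by rewrite fE; exact: is_derive_cst.
Qed.

Lemma is_derive_sum_seq (I : Type) (L : seq I) (F : I -> R -> R)
    (dF : I -> R) (s : R) :
  (forall i, is_derive s 1 (F i) (dF i)) ->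
  is_derive s 1 (fun r => \sum_(i <- L) F i r) (\sum_(i <- L) dF i).
Proof.
move=> Fs; elim: L => [|i L IH].
  rewrite big_nil (_ : (fun _ => _) = cst 0); first exact: is_derive_cst.
  by apply/funext => r; rewrite big_nil.
rewrite big_cons (_ : (fun _ => _) = F i + (fun r => \sum_(i <- L) F i r)).
  exact: is_deriveD.
by apply/funext => r; rewrite big_cons.
Qed.

Lemma derive1_is_derive (V : normedModType R) (f df : R -> V) :
  (forall r : R, is_derive r 1 f (df r)) -> derive1 f = df.
Proof. by move=> fdf; apply/funext => r; rewrite derive1E; case: (fdf r). Qed.

Lemma is_derive_mxP m n (F : R -> 'M[R]_(m, n)) (dF : 'M[R]_(m, n)) (s : R) :
  is_derive s 1 F dF <-> forall i j, is_derive s 1 (fun r => F r i j) (dF i j).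
Proof.
split=> [[/[dup] Fs /derivable_mxP Fij <-] i j|Fij].
  by rewrite derive_mx // mxE; exact: derivableP.
have Fs : derivable F s 1 by apply/derivable_mxP => i j; case: (Fij i j).
apply: DeriveDef => //; rewrite derive_mx //; apply/matrixP => i j.
by rewrite mxE; case: (Fij i j).
Qed.

Lemma is_derive_scale m n (f : R -> R) (F : R -> 'M[R]_(m, n)) df dF (s : R) :
  is_derive s 1 f df -> is_derive s 1 F dF ->
  is_derive s 1 (fun r => f r *: F r) (df *: F s + f s *: dF).
Proof.
move=> fs /is_derive_mxP Fs; apply/is_derive_mxP => i j.
have -> : (fun r => (f r *: F r) i j) = (fun r => f r * F r i j).
  by apply/funext => r; rewrite mxE.
by rewrite !mxE; exact: is_deriveMfun.
Qed.

End Derivatives.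

(** * Jets along a function *)

Section JetSubstitution.
Context {R : realType}.
Implicit Types (w v g h : jet R).

(** The total derivative is the chain rule along a function: on the variable
    [u_(p)] both sides are the derivative of order [p.+1], and both sides obey
    the product rule. *)
Lemma is_derive_jsubst w (k : R -> R) (s : R) : smooth k ->
  is_derive s 1 (jsubst w k) (jsubst (jD w) k s).
Proof.
move=> ks; move: w.
apply: (@jmonom_ind R
  (fun w => is_derive s 1 (jsubst w k) (jsubst (jD w) k s)))
  => [a w v IHw IHv||p w IH].
- have -> : jD (a *: w + v) = a *: jD w + jD v.
    exact: (total_der_lin jet_calculus).
  have -> : jsubst (a *: w + v) k = (fun s => a * jsubst w k s + jsubst v k s).
    by apply/funext => r; exact: jeval_lin.
  have -> : jsubst (a *: jD w + jD v) k s =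
      a * jsubst (jD w) k s + jsubst (jD v) k s.
    exact: jeval_lin.
  exact: (is_deriveD (is_deriveZ a IHw) IHv).
- have -> : jD (1 : jet R) = 0 by exact: (total_der1 jet_calculus).
  have -> : jsubst (1 : jet R) k = cst 1 by apply/funext => r; exact: jeval1.
  have -> : jsubst (0 : jet R) k s = 0 by exact: mmap0.
  exact: is_derive_cst.
- have -> : jD (jvar R p * w) = jvar R p * jD w + jvar R p.+1 * w.
    exact: (total_der_varM jet_calculus).
  have -> : jsubst (jvar R p * w) k = (fun s => derive1n p k s * jsubst w k s).
    by apply/funext => r; exact: jeval_jvarM.
  have -> : jsubst (jvar R p * jD w + jvar R p.+1 * w) k s =
     derive1n p.+1 k s * jsubst w k s + derive1n p k s * jsubst (jD w) k s.
    rewrite addrC; etransitivity; first exact: (@mmapD _ _ _ idfun).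
    by congr (_ + _); exact: jeval_jvarM.
  exact: (is_deriveMfun (is_derive1n p s ks) IH).
Qed.

Lemma jsubst_lenard g k s : jsubst (lenard_op g) k s =
  jsubst (jD (jD (jD g))) k s + 4 * k s * jsubst (jD g) k s
  + 2 * derive1 k s * jsubst g k s.
Proof.
exact: (eval_lenard jet_calculus (jeval_lin _) (jeval1 _) (jeval_jvarM _)).
Qed.

(** The Lenard relation removes the integral from the vector field. *)
Lemma local_field_lenard g h c s (k := curvature c) :
    jD h = lenard_op g -> jvanish0 h ->
  local_field (4 * g) c s =
    (4 * jsubst (jD (jD g)) k s + 8 * k s * jsubst g k s - 2 * jsubst h k s)
      *: frenet_t c s
    + (- (4 * jsubst (jD g) k s)) *: frenet_n c s
    + (4 * jsubst g k s) *: frenet_b c s.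
Proof.
move=> Dh h0; rewrite /local_field (jint_lenard Dh h0).
have [E1 E2 E3] := eval_field_coefs jet_calculus
  (jeval_lin (fun p => derive1n p k s)) (jeval1 _) (jeval_jvarM _) g h.
by congr (_ *: _ + _ *: _ + _ *: _).
Qed.

End JetSubstitution.

(** * The Minkowski form *)

Section Minkowski.
Context {R : realType}.

Lemma minkC (x y : 'rV[R]_3) : mink x y = mink y x.
Proof. by rewrite /mink; ring. Qed.

Lemma minkDl (x y z : 'rV[R]_3) : mink (x + y) z = mink x z + mink y z.
Proof. by rewrite /mink !mxE; ring. Qed.

Lemma minkZl a (x z : 'rV[R]_3) : mink (a *: x) z = a * mink x z.
Proof. by rewrite /mink !mxE; ring. Qed.

Lemma minkDr (x y z : 'rV[R]_3) : mink z (x + y) = mink z x + mink z y.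
Proof. by rewrite minkC minkDl !(minkC z). Qed.

Lemma minkZr a (x z : 'rV[R]_3) : mink z (a *: x) = a * mink z x.
Proof. by rewrite minkC minkZl (minkC z). Qed.

Definition minkE := (minkDl, minkDr, minkZl, minkZr).

Lemma is_derive_mink (F G : R -> 'rV[R]_3) dF dG (s : R) :
  is_derive s 1 F dF -> is_derive s 1 G dG ->
  is_derive s 1 (fun r => mink (F r) (G r)) (mink dF (G s) + mink (F s) dG).
Proof.
move=> /is_derive_mxP /(_ ord0) Fs /is_derive_mxP /(_ ord0) Gs.
pose M i j := is_deriveMfun (Fs (inord i)) (Gs (inord j)).
have -> : mink dF (G s) + mink (F s) dG =
    - ((dF ord0 (inord 0) * G s ord0 (inord 2) +
        F s ord0 (inord 0) * dG ord0 (inord 2)) +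
       (dF ord0 (inord 2) * G s ord0 (inord 0) +
        F s ord0 (inord 2) * dG ord0 (inord 0))) +
    (dF ord0 (inord 1) * G s ord0 (inord 1) +
        F s ord0 (inord 1) * dG ord0 (inord 1)).
  by rewrite /mink; ring.
exact: (is_deriveD (is_deriveN (is_deriveD (M 0 2) (M 2 0))) (M 1 1)).
Qed.

Lemma is_derive_mnorm2 (F : R -> 'rV[R]_3) dF (s : R) :
  is_derive s 1 F dF ->
  is_derive s 1 (fun r => mnorm2 (F r)) (2 * mink (F s) dF).
Proof.
move=> Fs; refine (is_derive_eq (is_derive_mink Fs Fs) _).
by rewrite (minkC dF); ring.
Qed.

(** The Gram matrix of the three vectors has determinant -1, whatever
    [mink c c] is, as has the matrix of the Minkowski form; so the determinant
    [D] of the three vectors satisfies [D ^+ 2 = 1].  The conclusion is Cramer's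
    rule for the linear system that says that [v] is orthogonal to them. *)
Lemma mink_frame_eq0 (t n c v : 'rV[R]_3) :
    mink t t = 0 -> mink t n = 0 -> mink n n = 1 -> mink t c = -1 ->
    mink n c = 0 ->
  mink t v = 0 -> mink n v = 0 -> mink c v = 0 -> v = 0.
Proof.
have I i : i = inord 0 \/ i = inord 1 \/ i = inord 2 :> 'I_3.
  case: i => [[|[|[|//]]] ?]; [left|right; left|right; right]; apply: val_inj;
    by rewrite /= inordK.
rewrite /mink.
set t0 := t _ (inord 0); set t1 := t _ (inord 1); set t2 := t _ (inord 2).
set n0 := n _ (inord 0); set n1 := n _ (inord 1); set n2 := n _ (inord 2).
set c0 := c _ (inord 0); set c1 := c _ (inord 1); set c2 := c _ (inord 2).
set v0 := v _ (inord 0); set v1 := v _ (inord 1); set v2 := v _ (inord 2).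
move=> tt tn nn tc nc tv nv cv.
pose D := t0 * (n1 * c2 - n2 * c1) - t1 * (n0 * c2 - n2 * c0)
          + t2 * (n0 * c1 - n1 * c0).
have D2 : D ^+ 2 = 1.
  pose tt' := - (t0 * t2 + t2 * t0) + t1 * t1.
  pose tn' := - (t0 * n2 + t2 * n0) + t1 * n1.
  pose tc' := - (t0 * c2 + t2 * c0) + t1 * c1.
  pose nn' := - (n0 * n2 + n2 * n0) + n1 * n1.
  pose nc' := - (n0 * c2 + n2 * c0) + n1 * c1.
  pose cc' := - (c0 * c2 + c2 * c0) + c1 * c1.
  transitivity (- (tt' * (nn' * cc' - nc' ^+ 2) - tn' * (tn' * cc' - nc' * tc')
                   + tc' * (tn' * nc' - nn' * tc'))).
    by rewrite /D /tt' /tn' /tc' /nn' /nc' /cc'; ring.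
  by rewrite /tt' /tn' /tc' /nn' /nc' tt tn nn tc nc; ring.
have D0 : D != 0.
  by apply/eqP => D0; move/eqP: D2; rewrite D0 expr0n /= eq_sym oner_eq0.
have K v' : D * v' = 0 -> v' = 0.
  by move=> /eqP; rewrite mulf_eq0 (negPf D0) => /eqP.
pose tv' := - (t0 * v2 + t2 * v0) + t1 * v1.
pose nv' := - (n0 * v2 + n2 * v0) + n1 * v1.
pose cv' := - (c0 * v2 + c2 * v0) + c1 * v1.
have cramer x1 x2 x3 : - (tv' * x1 - nv' * x2 + cv' * x3) = 0.
  by rewrite /tv' /nv' /cv' tv nv cv; ring.
have Kv0 : v0 = 0.
  apply: K; rewrite -[RHS](cramer (n0 * c1 - n1 * c0) (t0 * c1 - t1 * c0)
    (t0 * n1 - t1 * n0)) /D /tv' /nv' /cv'; ring.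
have Kv1 : v1 = 0.
  apply: K; rewrite -[RHS](cramer (n0 * c2 - n2 * c0) (t0 * c2 - t2 * c0)
    (t0 * n2 - t2 * n0)) /D /tv' /nv' /cv'; ring.
have Kv2 : v2 = 0.
  apply: K; rewrite -[RHS](cramer (n1 * c2 - n2 * c1) (t1 * c2 - t2 * c1)
    (t1 * n2 - t2 * n1)) /D /tv' /nv' /cv'; ring.
apply/rowP => i; rewrite mxE; rewrite /v0 /v1 /v2 in Kv0 Kv1 Kv2.
by rewrite -[X in v X i](ord1 ord0); case: (I i) => [->|[->|->]].
Qed.

End Minkowski.

(** * Null curves *)

Section NullFrame.
Context {R : realType}.
(** A vector frame along a null curve, in which [t], [n], [b] stand for the
    first three derivatives.  Compared with the Frenet frame, [b] is the third
    derivative itself, so that the frame equations for [t] and [n] are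
    trivial. *)
Variables (t n b b' : R -> 'rV[R]_3) (k : R -> R).
Hypothesis dt : forall r : R, is_derive r 1 t (n r).
Hypothesis dn : forall r : R, is_derive r 1 n (b r).
Hypothesis db : forall r : R, is_derive r 1 b (b' r).
Hypothesis tt : forall r, mink (t r) (t r) = 0.
Hypothesis nn : forall r, mink (n r) (n r) = 1.
Hypothesis bb : forall r, mink (b r) (b r) = 4 * k r.

(* Each scalar product below comes from differentiating an earlier one. *)
Let tn r : mink (t r) (n r) = 0.
Proof.
have := is_derive_const (is_derive_mink (dt r) (dt r)) tt.
by rewrite (minkC (n r)) => E; lra.
Qed.

Let tb r : mink (t r) (b r) = -1.
Proof.
have := is_derive_const (is_derive_mink (dt r) (dn r)) tn.
by rewrite nn => E; lra.
Qed.

Let nb r : mink (n r) (b r) = 0.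
Proof.
have := is_derive_const (is_derive_mink (dn r) (dn r)) nn.
by rewrite (minkC (b r)) => E; lra.
Qed.

(** Both sides have the same scalar products with [t], [n] and [b], obtained by
    differentiating those of the frame with [b]. *)
Lemma null_frame_ode (dk r : R) : is_derive r 1 k dk ->
  b' r = - (2 * dk) *: t r + (- (4 * k r)) *: n r.
Proof.
move=> kr; apply/eqP; rewrite -subr_eq0; apply/eqP.
have tb' : mink (t r) (b' r) = 0.
  have := is_derive_const (is_derive_mink (dt r) (db r)) tb.
  by rewrite nb => E; lra.
have nb' : mink (n r) (b' r) = - (4 * k r).
  have := is_derive_const (is_derive_mink (dn r) (db r)) nb.
  by rewrite bb => E; lra.
have bb' : mink (b r) (b' r) = 2 * dk.
  have dbb : is_derive r 1 (fun r => mink (b r) (b r)) (4 * dk).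
    by rewrite (funext bb); exact: (is_deriveZ (4 : R) kr).
  have := is_derive_unique dbb (is_derive_mink (db r) (db r)).
  by rewrite (minkC (b' r)) => E; lra.
rewrite -[X in _ - X]scale1r -scaleNr.
apply: (@mink_frame_eq0 R (t r) (n r) (b r)) => //; rewrite !minkE.
- by rewrite tb' tt tn; ring.
- by rewrite nb' (minkC (n r) (t r)) tn nn; ring.
- by rewrite bb' !(minkC (b r)) tb nb; ring.
Qed.

Lemma is_derive_frame (a1 a2 a3 : R -> R) (dk d1 d2 d3 r : R) :
    is_derive r 1 k dk ->
    is_derive r 1 a1 d1 -> is_derive r 1 a2 d2 -> is_derive r 1 a3 d3 ->
  is_derive r 1 (fun r => a1 r *: t r + a2 r *: n r + a3 r *: b r)
    ((d1 - 2 * dk * a3 r) *: t r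
      + (a1 r + d2 - 4 * k r * a3 r) *: n r + (a2 r + d3) *: b r).
Proof.
move=> kr D1 D2 D3.
have := is_deriveD (is_deriveD (is_derive_scale D1 (dt r))
  (is_derive_scale D2 (dn r))) (is_derive_scale D3 (db r)).
set E := (X in is_derive _ _ _ X -> _) => H.
suff -> : (d1 - 2 * dk * a3 r) *: t r
    + (a1 r + d2 - 4 * k r * a3 r) *: n r + (a2 r + d3) *: b r = E by exact: H.
rewrite /E (null_frame_ode kr); apply/rowP => i.
by rewrite !mxE; ring.
Qed.

Hypothesis kS : smooth k.

(** For the field [V] of [4 g], the Lenard relation collapses the first
    derivative to [2 h' t - 2 h n].  Two more derivatives give
    [V''' = (2 h''' + 4 k' h) t + (2 h'' + 8 k h) n - 2 h' b], whose scalar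
    product with [b] is [-2 (h''' + 4 k h' + 2 k' h)]. *)
Lemma mink_derive1n3_lenard (g h : jet R) (V : R -> 'rV[R]_3) (s : R) :
    jD h = lenard_op g ->
    (forall r, V r =
      (4 * jsubst (jD (jD g)) k r + 16 * (k r * jsubst g k r)
        - 2 * jsubst h k r) *: t r
      + (- (4 * jsubst (jD g) k r)) *: n r + (4 * jsubst g k r) *: b r) ->
  mink (b s) (derive1n 3 V s) = - (2 * jsubst (lenard_op h) k s).
Proof.
move=> Dh /funext V0.
pose g0 := jsubst g k; pose g1 := jsubst (jD g) k.
pose g2 := jsubst (jD (jD g)) k; pose g3 := jsubst (jD (jD (jD g))) k.
pose e0 := jsubst h k; pose e1 := jsubst (jD h) k.
pose e2 := jsubst (jD (jD h)) k; pose e3 := jsubst (jD (jD (jD h))) k.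
have D w (r : R) : is_derive r 1 (jsubst w k) (jsubst (jD w) k r).
  exact: (is_derive_jsubst w r kS).
have scaleE (a x : R) : a *: x = a * x by [].
have dk (r : R) : is_derive r 1 k (derive1 k r) := is_derive1n 0 r kS.
have e1E r : e1 r = g3 r + 4 * k r * g1 r + 2 * derive1 k r * g0 r.
  by rewrite /e1 Dh jsubst_lenard.
have V1 : derive1 V = fun r =>
    (2 * e1 r) *: t r + (- (2 * e0 r)) *: n r + 0 *: b r.
  rewrite V0; apply: derive1_is_derive => r.
  have H := is_derive_frame (dk r)
    (is_deriveB (is_deriveD (is_deriveZ (4 : R) (D (jD (jD g)) r))
       (is_deriveZ (16 : R) (is_deriveMfun (dk r) (D g r))))
       (is_deriveZ (2 : R) (D h r)))
    (is_deriveN (is_deriveZ (4 : R) (D (jD g) r))) (is_deriveZ (4 : R) (D g r)).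
  refine (is_derive_eq H _).
  rewrite -/g0 -/g1 -/g2 -/g3 -/e0 -/e1.
  by apply/rowP => i; rewrite !mxE !fctE /= !scaleE e1E; ring.
have V2 : derive1 (derive1 V) = fun r =>
    (2 * e2 r) *: t r + 0 *: n r + (- (2 * e0 r)) *: b r.
  rewrite V1; apply: derive1_is_derive => r.
  have H := is_derive_frame (dk r) (is_deriveZ (2 : R) (D (jD h) r))
    (is_deriveN (is_deriveZ (2 : R) (D h r))) (is_derive_cst 0 r 1).
  refine (is_derive_eq H _).
  rewrite -/e0 -/e1 -/e2.
  by apply/rowP => i; rewrite !mxE !fctE /= !scaleE; ring.
have V3 : derive1 (derive1 (derive1 V)) = fun r =>
    (2 * e3 r + 4 * derive1 k r * e0 r) *: t r
    + (2 * e2 r + 8 * k r * e0 r) *: n r + (- (2 * e1 r)) *: b r.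
  rewrite V2; apply: derive1_is_derive => r.
  have H := is_derive_frame (dk r) (is_deriveZ (2 : R) (D (jD (jD h)) r))
    (is_derive_cst 0 r 1) (is_deriveN (is_deriveZ (2 : R) (D h r))).
  refine (is_derive_eq H _).
  rewrite -/e0 -/e1 -/e2 -/e3.
  by apply/rowP => i; rewrite !mxE !fctE /= !scaleE; ring.
rewrite (_ : derive1n 3 V s = derive1 (derive1 (derive1 V)) s) // V3.
rewrite !minkE (minkC (b s) (t s)) (minkC (b s) (n s)) tb nb bb jsubst_lenard.
rewrite -/e0 -/e1 -/e3; ring.
Qed.

End NullFrame.

(** The derivatives of the curvature are sums of scalar products of two
    derivatives of the curve; it is enough to keep track of the list of the
    pairs of orders that occur. *)
Lemma curvature_smooth (R : realType) (c : R -> 'rV[R]_3) :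
  smooth_curve c -> smooth (curvature c).
Proof.
move=> cS; pose C i := derive1n i c.
have dsum (L : seq (nat * nat)) (s : R) :
    is_derive s 1
      (fun r => \sum_(ij <- L) 4^-1 * mink (C ij.1 r) (C ij.2 r))
      (\sum_(ij <- L) 4^-1 *
         (mink (C ij.1.+1 s) (C ij.2 s) + mink (C ij.1 s) (C ij.2.+1 s))).
  apply: is_derive_sum_seq => -[i j] /=.
  exact: (is_deriveZ (4^-1 : R)
    (is_derive_mink (is_derive1n i s cS) (is_derive1n j s cS))).
have kE m : exists L : seq (nat * nat), derive1n m (curvature c) =
    (fun s => \sum_(ij <- L) 4^-1 * mink (C ij.1 s) (C ij.2 s)).
  elim: m => [|m [L EL]].
    by exists [:: (3, 3)%N]; apply/funext => s; rewrite big_seq1.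
  exists ([seq (ij.1.+1, ij.2) | ij <- L] ++ [seq (ij.1, ij.2.+1) | ij <- L]).
  rewrite derive1nS EL (derive1_is_derive (dsum L)); apply/funext => s.
  rewrite big_cat /= !big_map -big_split /=; apply: eq_bigr => ij _.
  by rewrite mulrDr.
by move=> m s; have [L ->] := kE m; have [] := dsum L s.
Qed.

Lemma mink_derive1n3_local_field (R : realType) (c : R -> 'rV[R]_3)
    (g h : jet R) (s : R) :
    null_curves c -> jD h = lenard_op g -> jvanish0 h ->
  mink (derive1n 3 c s) (derive1n 3 (local_field (4 * g) c) s) =
    - (2 * jsubst (lenard_op h) (curvature c) s).
Proof.
move=> [[cS _ nc] _ pc] Dh h0.
have tt r : mink (derive1n 1 c r) (derive1n 1 c r) = 0 by have [] := nc r.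
have kS := curvature_smooth cS.
have bb r : mink (derive1n 3 c r) (derive1n 3 c r) = 4 * curvature c r.
  by rewrite /curvature /mnorm2; field.
apply: (@mink_derive1n3_lenard R _ (derive1n 2 c) _ _ _
  (fun r => is_derive1n 1 r cS) (fun r => is_derive1n 2 r cS)
  (fun r => is_derive1n 3 r cS) tt pc bb kS g h) => // r.
rewrite (local_field_lenard _ _ Dh h0) /frenet_b.
have -> : 2^-1 * mnorm2 (derive1n 3 c r) = 2 * curvature c r.
  by rewrite /curvature; field.
rewrite /frenet_t /frenet_n derive1n1 -/(curvature c).
move: (derive1 c r) (derive1n 2 c r) (derive1n 3 c r) => v1 v2 v3.
by apply/rowP => i; rewrite !mxE; ring.
Qed.

(** * Exchange of partial derivatives *)

Section Schwarz.
Context {R : realType}.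

(** The second difference over a square is the increment of the increments of
    [F] in its second variable; hence two applications of the mean value
    theorem, to [F] in the first variable and to [F1] in the second. *)
Lemma second_difference_MVT (F F1 F12 : R -> R -> R) (s t h : R) : 0 < h ->
    (forall x y, x \in `[s, s + h]%R -> y \in `[t, t + h]%R ->
       is_derive x 1 (F ^~ y) (F1 x y) /\ is_derive y 1 (F1 x) (F12 x y)) ->
  exists x y, [/\ x \in `[s, s + h]%R, y \in `[t, t + h]%R &
    F (s + h) (t + h) - F (s + h) t - (F s (t + h) - F s t) = F12 x y * h * h].
Proof.
move=> h0 dF.
have ltd (a : R) : a < a + h by rewrite ltrDl.
have sub (a x : R) : x \in `]a, a + h[%R -> x \in `[a, a + h]%R.
  by rewrite !in_itv /= => /andP[/ltW-> /ltW->].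
have ends (a : R) : (a \in `[a, a + h]%R) * (a + h \in `[a, a + h]%R).
  by rewrite !in_itv /= !lexx ltW.
have hE (a : R) : a + h - a = h by rewrite addrAC subrr add0r.
pose f x := F x (t + h) - F x t.
have df x : x \in `[s, s + h]%R -> is_derive x 1 f (F1 x (t + h) - F1 x t).
  move=> xs; have [H1 _] := dF x _ xs (ends t).2.
  by have [H2 _] := dF x _ xs (ends t).1; exact: is_deriveB.
have cf : {within `[s, s + h], continuous f}.
  by apply: derivable_within_continuous => x /df [].
have [x /sub xs] := MVT (ltd s) (fun x xs => df x (sub s x xs)) cf.
have dF1 y : y \in `[t, t + h]%R -> is_derive y 1 (F1 x) (F12 x y).
  by move=> yt; have [_] := dF x y xs yt.
have cF1 : {within `[t, t + h], continuous (F1 x)}.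
  by apply: derivable_within_continuous => y /dF1 [].
have [y /sub yt] := MVT (ltd t) (fun y yt => dF1 y (sub t y yt)) cF1.
by rewrite !hE => -> fE; exists x, y; rewrite -fE.
Qed.

(** The second difference of [F] over a small square of side [h] is both
    [F12 x y * h * h] and [F21 x' y' * h * h] for points of that square, and
    both mixed derivatives are continuous at its corner. *)
Lemma schwarz (F F1 F2 F12 F21 : R -> R -> R) (A : set (R * R)) (s t : R) :
    open A -> A (s, t) ->
    (forall z, A z -> [/\ is_derive z.1 1 (F ^~ z.2) (F1 z.1 z.2),
       is_derive z.2 1 (F z.1) (F2 z.1 z.2),
       is_derive z.2 1 (F1 z.1) (F12 z.1 z.2) &
       is_derive z.1 1 (F2 ^~ z.2) (F21 z.1 z.2)]) ->
    {for (s, t), continuous (fun z => F12 z.1 z.2)} ->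
    {for (s, t), continuous (fun z => F21 z.1 z.2)} ->
  F12 s t = F21 s t.
Proof.
move=> oA Ast dF c12 c21; apply/eqP.
rewrite -subr_eq0 -normr_eq0 eq_le normr_ge0 andbT.
apply/ler_addgt0Pl => e e0; rewrite addr0.
have e2 : 0 < e / 2 by rewrite divr_gt0.
have : \forall z \near (s, t), [/\ A z, `|F12 s t - F12 z.1 z.2| < e / 2 &
    `|F21 s t - F21 z.1 z.2| < e / 2].
  near=> z; split; near: z; first exact: open_nbhs_nbhs.
    by move/cvgrPdist_lt: c12; exact.
  by move/cvgrPdist_lt: c21; exact.
move=> /nbhs_ballP[r /= r0 rP].
pose h := r / 2; have h0 : 0 < h by rewrite divr_gt0.
have hr : h < r by rewrite /h; lra.
have in_ball (x y : R) : x \in `[s, s + h]%R -> y \in `[t, t + h]%R ->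
    ball (s, t) r (x, y).
  rewrite !in_itv /= => /andP[sx xs] /andP[ty yt].
  by split; rewrite /ball /= ltr_distlC; apply/andP; split; lra.
have dF' (x y : R) (xs : x \in `[s, s + h]%R) (yt : y \in `[t, t + h]%R) :
    [/\ is_derive x 1 (F ^~ y) (F1 x y), is_derive y 1 (F x) (F2 x y),
        is_derive y 1 (F1 x) (F12 x y) & is_derive x 1 (F2 ^~ y) (F21 x y)].
  by have [/dF] := rP _ (in_ball _ _ xs yt).
have dF1 (x y : R) (xs : x \in `[s, s + h]%R) (yt : y \in `[t, t + h]%R) :
    is_derive x 1 (F ^~ y) (F1 x y) /\
    is_derive y 1 (F1 x) (F12 x y) by have [] := dF' x y xs yt.
have dF2 (y x : R) (yt : y \in `[t, t + h]%R) (xs : x \in `[s, s + h]%R) :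
    is_derive y 1 (F x) (F2 x y) /\
    is_derive x 1 (F2 ^~ y) (F21 x y) by have [] := dF' x y xs yt.
have [x [y [xs yt E1]]] := @second_difference_MVT F F1 F12 s t h h0 dF1.
have [y' [x' [yt' xs' E2]]] := @second_difference_MVT (fun y x => F x y)
  (fun y x => F2 x y) (fun y x => F21 x y) t s h h0 dF2.
have E : F12 x y = F21 x' y'.
  apply: (mulIf (lt0r_neq0 h0)); apply: (mulIf (lt0r_neq0 h0)).
  by rewrite -E1 -E2; ring.
have [_ /= B1 _] := rP _ (in_ball _ _ xs yt).
have [_ _ /= B2] := rP _ (in_ball _ _ xs' yt').
rewrite (_ : _ - _ = (F12 s t - F12 x y) - (F21 s t - F21 x' y')); last first.
  by rewrite E; ring.
by rewrite (le_trans (ler_normB _ _)) // (splitr e) lerD // ltW.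
Unshelve. all: by end_near. Qed.

Lemma dsnd_dfst m n (A : set (R * R)) (F : R -> R -> 'M[R]_(m, n)) (s t : R) :
  open A -> class_C 2 A F -> A (s, t) ->
  dsnd (dfst F) s t = dfst (dsnd F) s t.
Proof.
move=> oA [_ [dF [_ [dF1 _ [c12 _]]] [_ [dF2 [c21 _] _]]]] Ast.
apply/matrixP => i j.
have cont_ij (G : R -> R -> 'M[R]_(m, n)) :
    (forall z, A z -> {for z, continuous (fun z : R * R => G z.1 z.2)}) ->
    {for (s, t), continuous (fun z : R * R => G z.1 z.2 i j)}.
  move=> /(_ _ Ast) cG.
  apply: (@continuous_comp _ _ _ (fun z : R * R => G z.1 z.2)
    (fun M : 'M[R]_(m, n) => M i j)); first exact: cG.
  exact: coord_continuous.
apply: (@schwarz (fun x y => F x y i j) (fun x y => dfst F x y i j)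
  (fun x y => dsnd F x y i j) (fun x y => dsnd (dfst F) x y i j)
  (fun x y => dfst (dsnd F) x y i j) A) => //.
- move=> z Az; have [/is_derive_derive1 D1 /is_derive_derive1 D2] := dF z Az.
  have [_ /is_derive_derive1 D12] := dF1 z Az.
  have [/is_derive_derive1 D21 _] := dF2 z Az.
  split.
  + by move/is_derive_mxP: D1; exact.
  + by move/is_derive_mxP: D2; exact.
  + by move/is_derive_mxP: D12; exact.
  + by move/is_derive_mxP: D21; exact.
- exact (cont_ij _ c12).
- exact (cont_ij _ c21).
Qed.

Lemma smooth_on_dfst (V : normedModType R) (A : set (R * R)) (F : R -> R -> V) :
  smooth_on A F -> smooth_on A (dfst F).
Proof. by move=> FS k; have [_ []] := FS k.+1. Qed.

(** A derivative in the second variable passes through all the derivatives in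
    the first one, one at a time.  Each step uses the exchange at all points of
    a line on which the second variable is constant. *)
Lemma dsnd_derive1n m n (I : set R) (F : R -> R -> 'M[R]_(m, n)) k (s t : R) :
    open I -> smooth_on [set z : R * R | I z.2] F -> I t ->
  is_derive t 1 (fun t' => derive1n k (F ^~ t') s)
    (derive1n k (fun r => dsnd F r t) s).
Proof.
move=> oI FS It; have oA : open [set z : R * R | I z.2].
  by apply: open_comp => // z _; exact: cvg_snd.
pose Fk k := iter k (@dfst R 'M[R]_(m, n)) F.
have FkE j r t' : Fk j r t' = derive1n j (F ^~ t') r.
  elim: j r => [|j IH] r; first by [].
  exact (congr1 (fun G => derive1 G r) (funext IH)).
have FkS j : smooth_on [set z : R * R | I z.2] (Fk j).
  by elim: j => [|j IH]; [exact: FS|exact: smooth_on_dfst].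
have dFk j r : dsnd (Fk j) r t = derive1n j (fun r => dsnd F r t) r.
  elim: j r => [|j IH] r; first by [].
  etransitivity; first exact (@dsnd_dfst m n _ (Fk j) r t oA (FkS j 2%N) It).
  exact (congr1 (fun G => derive1 G r) (funext IH)).
rewrite (_ : (fun t' => _) = Fk k s); last by apply/funext => t'; rewrite FkE.
rewrite -dFk; apply: is_derive_derive1.
by have [_ [/(_ (s, t) It) []]] := FkS k 1%N.
Qed.

End Schwarz.

(** * Motions of null curves *)

Theorem theorem2 (R : realType) (g p : nat -> jet R)
    (hgp : lenard_seq g p) (n : nat) (hn : (2 <= n)%N) :
  jeuler (jvar R 1 * (4 * g (n - 2)%N)) = 0 /\
  forall (I : set R) (Gam : R -> R -> 'rV[R]_3),
    local_motion (4 * g (n - 2)%N) I Gam ->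
    forall s t : R, I t ->
      is_derive t (1 : R) (fun t' => curvature (Gam ^~ t') s : R)
        (- jsubst (jD (g n)) (curvature (Gam ^~ t)) s).
Proof.
case: hgp => _ _ rec; set m := (n - 2)%N.
have nE : n = m.+2 by rewrite -addn2 subnK.
have [Dh _ h0] := rec m.+1 isT; have [Dw _ _] := rec m.+2 isT.
rewrite [in g n]nE; move: (g m) (g m.+1) (g m.+2) Dh h0 Dw => g0 h w Dh h0 Dw.
split.
  have <- := jD_lenard_primitive Dh; exact: jeuler_jD.
move=> I Gam [[oI _] GamS GamM GamV] s t It.
have VE : (fun r => dsnd Gam r t) = local_field (4 * g0) (Gam ^~ t).
  by apply/funext => r; exact: GamV.
have D := dsnd_derive1n 3 s oI GamS It; rewrite VE in D.
have H := is_deriveZ (4^-1 : R) (is_derive_mnorm2 D).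
refine (is_derive_eq H _).
have E := mink_derive1n3_local_field s (GamM t It) Dh h0.
refine (etrans (congr1 (fun x => 4^-1 * (2 * x)) E) _).
by rewrite Dw; field.
Qed.
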